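(* There is no unit weighing matrix $UW(7,5)$.
   Context: $\mathbb{T}$ is the set of complex numbers of absolute value one. A unit weighing matrix $UW(n,p)$ is an $n\times n$ matrix $W$ with entries in $\mathbb{T}\cup\{0\}$ such that $WW^*=pI_n$, where $^*$ is the Hermitian transpose. *)

(* Defs.v *)
From mathcomp Require Import all_boot all_order all_algebra.
From mathcomp Require Import complex reals.

Set Implicit Arguments.
Unset Strict Implicit.
Unset Printing Implicit Defensive.

Import Order.TTheory GRing.Theory Num.Theory.
Local Open Scope ring_scope.
Local Open Scope complex_scope.
Local Open Scope sesquilinear_scope.

(* The complex numbers are [R[i]] for [R : realType], a model of the reals;
   on [R[i]], [`|z|] is the modulus and [M ^t*] the conjugate transpose. *)
Definition unit_circle {R : realType} : {pred R[i]} :=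
  [pred z : R[i] | `|z| == 1].

Definition unit_weighing (R : realType) (n p : nat) (W : 'M[R[i]]_n) : Prop :=
  (forall i j, W i j \in unit_circle \/ W i j = 0) /\
  W *m W ^t* = p%:R *: 1%:M.

(* Main.v *)
(* Three unimodular numbers with sum 0 have equal cubes, whereas four unimodular
   numbers with sum 0 form two pairs of opposites, so no three of them have
   equal cubes. Every row and column of a UW(7,5) has exactly two zeros; write
   Z i for the zeros of row i. If Z i and Z j are disjoint, rows i and j share
   three support columns, so the cubes of their entrywise ratios are constant
   there. Since 7 is odd, the sets Z i cannot pair up the columns, so two rows r,
   s share exactly one zero, hence four support columns. At least three rows have
   zeros disjoint from Z r and Z s, and two of them, t and u, have Z t <> Z u.
   Comparing r and s through t and through u makes the cubed ratio of r and s
   constant on three of their four common support columns. *)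
Require Import Defs.
From mathcomp Require Import all_boot all_order all_algebra.
From mathcomp Require Import complex reals.
From mathcomp Require Import ring zify.

Import Order.TTheory GRing.Theory Num.Theory.

Local Open Scope ring_scope.
Local Open Scope complex_scope.

(** * Vanishing sums of three or four unimodular numbers *)

Section Unimodular.

Context {C : numClosedFieldType}.
Implicit Types x y z w : C.

Lemma norm1_mul_conj x : `|x| = 1 -> x * x^* = 1.
Proof. by move=> hx; rewrite -normCK hx expr1n. Qed.

Lemma norm1_neq0 x : `|x| = 1 -> x != 0.
Proof. by move=> hx; rewrite -normr_gt0 hx ltr01. Qed.

(** Conjugation inverts unimodular numbers, so conjugating the relation and multiplying by
    [x * y * z] kills the second elementary symmetric function too: all three are roots of
    [X^3 = x * y * z]. *)
Lemma unimodular_sum3_cube {x y z} :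
  `|x| = 1 -> `|y| = 1 -> `|z| = 1 -> x + y + z = 0 -> x ^+ 3 = y ^+ 3.
Proof.
move=> /norm1_mul_conj hx /norm1_mul_conj hy /norm1_mul_conj hz s0.
have s0' : x^* + y^* + z^* = 0 by rewrite -!rmorphD s0 rmorph0.
have e2 : y * z + x * z + x * y = 0.
  transitivity (x * y * z * (x^* + y^* + z^*)); last by rewrite s0' mulr0.
  transitivity (y * z * (x * x^*) + x * z * (y * y^*) + x * y * (z * z^*)).
    by rewrite hx hy hz !mulr1.
  by ring.
apply/eqP; rewrite -subr_eq0; apply/eqP.
transitivity ((x - y) * ((x + y) * (x + y + z) - (y * z + x * z + x * y))).
  by ring.
by rewrite s0 e2; ring.
Qed.

(* With e1 = 0 and, by conjugation, e3 = 0, the product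
   (x + y)(x + z)(x + w) = x^2 e1 + e3 vanishes: the four numbers form two
   pairs of opposites, one of which lies among x, y, z. *)
Lemma unimodular_sum4_cube {x y z w} :
  `|x| = 1 -> `|y| = 1 -> `|z| = 1 -> `|w| = 1 -> x + y + z + w = 0 ->
  x ^+ 3 = y ^+ 3 -> x ^+ 3 = z ^+ 3 -> False.
Proof.
move=> nx ny nz nw s0 xy xz.
have hx := norm1_mul_conj _ nx; have hy := norm1_mul_conj _ ny.
have hz := norm1_mul_conj _ nz; have hw := norm1_mul_conj _ nw.
have s0' : x^* + y^* + z^* + w^* = 0 by rewrite -!rmorphD s0 rmorph0.
have e3 : y * z * w + x * z * w + x * y * w + x * y * z = 0.
  transitivity (x * y * z * w * (x^* + y^* + z^* + w^*)).
    transitivity (y * z * w * (x * x^*) + x * z * w * (y * y^*)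
                  + x * y * w * (z * z^*) + x * y * z * (w * w^*)).
      by rewrite hx hy hz hw !mulr1.
    by ring.
  by rewrite s0' mulr0.
(* Opposite numbers have opposite cubes, here nonzero. *)
have opp_cube (a b : C) : `|a| = 1 -> a ^+ 3 = b ^+ 3 -> a + b = 0 -> False.
  move=> na ab /eqP; rewrite addr_eq0 => /eqP aE.
  have : a ^+ 3 *+ 2 = 0 by rewrite mulr2n {2}ab aE; ring.
  by move/eqP; rewrite mulrn_eq0 expf_eq0 /= (negPf (norm1_neq0 _ na)).
have : (x + y) * (x + z) * (x + w) == 0.
  apply/eqP; transitivity (x ^+ 2 * (x + y + z + w)
    + (y * z * w + x * z * w + x * y * w + x * y * z)); first by ring.
  by rewrite s0 e3 mulr0 addr0.
rewrite !mulf_eq0 => /orP[/orP[]|] /eqP h.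
- exact: opp_cube h.
- exact: opp_cube h.
(* If [w] is the opposite of [x], then [y] and [z] form the other pair. *)
- apply: (opp_cube y z ny); first by rewrite -xy.
  by rewrite -s0 -[LHS](addr0) -h; ring.
Qed.

Lemma unimodular_sum_card3 {I : finType} {A : {set I}} {f : I -> C} {i j} :
  #|A| = 3%N -> {in A, forall k, `|f k| = 1} -> \sum_(k in A) f k = 0 ->
  i \in A -> j \in A -> f i ^+ 3 = f j ^+ 3.
Proof.
move=> cA f1 s0 iA jA; have [->//|ij] := eqVneq i j.
have jA' : j \in A :\ i by rewrite !inE eq_sym ij.
have /cards1P[k Ak] : #|A :\ i :\ j| == 1%N.
  by move: cA; rewrite (cardsD1 i) iA (cardsD1 j (A :\ i)) jA' => -[/eqP].
have kA : k \in A :\ i :\ j by rewrite Ak set11.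
apply: (unimodular_sum3_cube (f1 _ iA) (f1 _ jA) (z := f k)).
  by apply: f1; move: kA; rewrite !inE => /and3P[].
by rewrite -s0 (big_setD1 i) //= (big_setD1 j) //= Ak big_set1 addrA.
Qed.

Lemma unimodular_sum_card4 {I : finType} {A : {set I}} {f : I -> C} {i j k} :
  #|A| = 4%N -> {in A, forall l, `|f l| = 1} -> \sum_(l in A) f l = 0 ->
  i \in A -> j \in A -> k \in A -> uniq [:: i; j; k] ->
  f i ^+ 3 = f j ^+ 3 -> f i ^+ 3 = f k ^+ 3 -> False.
Proof.
move=> cA f1 s0 iA jA kA; rewrite /= !inE negb_or andbT => /andP[/andP[ij ik] jk].
have jA' : j \in A :\ i by rewrite !inE eq_sym ij.
have kA' : k \in A :\ i :\ j by rewrite !inE eq_sym jk eq_sym ik.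
have /cards1P[l Al] : #|A :\ i :\ j :\ k| == 1%N.
  move: cA; rewrite (cardsD1 i) iA (cardsD1 j (A :\ i)) jA'.
  by rewrite (cardsD1 k (A :\ i :\ j)) kA' => -[/eqP].
have lA : l \in A :\ i :\ j :\ k by rewrite Al set11.
apply: (unimodular_sum4_cube (f1 _ iA) (f1 _ jA) (f1 _ kA) (w := f l)).
  by apply: f1; move: lA; rewrite !inE => /and4P[].
by rewrite -s0 (big_setD1 i) //= (big_setD1 j) //= (big_setD1 k) //= Al
  big_set1 !addrA.
Qed.

End Unimodular.

(** * Families of pairs covering every point exactly twice *)

Section TwoRegular.

Context {n : nat} {Z : 'I_n -> {set 'I_n}}.
Hypothesis cardZ : forall i, #|Z i| = 2%N.
Hypothesis cardZt : forall j, #|[set i | j \in Z i]| = 2%N.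

(* Otherwise the sets Z i partition 'I_n into pairs. *)
Lemma odd_two_regular_meet1 : odd n -> exists r s, #|Z r :&: Z s| = 1%N.
Proof.
move=> n_odd; case: (boolP [exists r, exists s, #|Z r :&: Z s| == 1%N]).
  by move=> /existsP[r /existsP[s /eqP]]; exists r, s.
move=> no1; suff /card_uniform_partition : partition (Z @: setT) setT.
  have Z2 : {in Z @: setT, forall A : {set 'I_n}, #|A| = 2%N} by move=> _ /imsetP[i _ ->].
  move=> /(_ 2%N Z2)/(congr1 odd).
  by rewrite cardsT card_ord n_odd oddM andbF.
apply/and3P; split.
- apply/eqP/setP => j; rewrite inE; apply/bigcupP.
  have /set0Pn[k] : [set i | j \in Z i] != set0 by rewrite -card_gt0 cardZt.
  by rewrite inE => jk; exists (Z k) => //; apply: imset_f.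
- apply/trivIsetP => _ _ /imsetP[i _ ->] /imsetP[j _ ->].
  rewrite -setI_eq0; apply: contraR => ij0.
  have ij1 : #|Z i :&: Z j| != 1%N.
    by apply: contra no1 => ij1; apply/existsP; exists i; apply/existsP; exists j.
  have ij2 : (2 <= #|Z i :&: Z j|)%N.
    by rewrite ltn_neqAle eq_sym ij1 card_gt0.
  have /eqP <- : Z i :&: Z j == Z i by rewrite eqEcard subsetIl cardZ.
  by rewrite eqEcard subsetIr cardZ.
- by apply/imsetP => -[i _ /esym Zi0]; move: (cardZ i); rewrite Zi0 cards0.
Qed.

Lemma two_regular_configuration : odd n -> (7 <= n)%N ->
  exists r s t u, [/\ #|Z r :&: Z s| = 1%N, [disjoint Z t & Z r :|: Z s],
    [disjoint Z u & Z r :|: Z s] & Z t != Z u].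
Proof.
move=> n_odd n7; have [r [s rs1]] := odd_two_regular_meet1 n_odd.
have /eqP/cards1P[a rsa] := rs1.
have : a \in Z r :&: Z s by rewrite rsa set11.
rewrite inE => /andP[ra sa].
have /eqP/cards1P[b rb] : #|Z r :\ a| = 1%N.
  by move: (cardZ r); rewrite (cardsD1 a) ra => -[].
have /eqP/cards1P[c sc] : #|Z s :\ a| = 1%N.
  by move: (cardZ s); rewrite (cardsD1 a) sa => -[].
have br : b \in Z r by have := set11 b; rewrite -rb inE => /andP[].
have cs : c \in Z s by have := set11 c; rewrite -sc inE => /andP[].
pose col j := [set i | j \in Z i].
pose M := col a :|: col b :|: col c.
(* Of the 2 + 2 + 2 incidences, [r] is counted for both [a] and [b], and [s] for both [a] and
   [c]. *)
have leM : (#|M| <= 4)%N.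
  have h1 : (0 < #|col a :&: col b|)%N.
    by rewrite card_gt0; apply/set0Pn; exists r; rewrite !inE ra br.
  have h2 : (0 < #|(col a :|: col b) :&: col c|)%N.
    by rewrite card_gt0; apply/set0Pn; exists s; rewrite !inE sa cs.
  rewrite /M cardsU cardsU !cardZt; lia.
have TP t : t \in ~: M -> [disjoint Z t & Z r :|: Z s].
  rewrite !inE !negb_or => /andP[/andP[at' bt] ct].
  rewrite -setI_eq0; apply/eqP/setP => j; rewrite !inE.
  apply/negP => /andP[jt /orP[jr|js]].
  - have [ja|ja] := eqVneq j a; first by rewrite -ja jt in at'.
    have : j \in Z r :\ a by rewrite !inE ja.
    by rewrite rb inE => /eqP jb; rewrite -jb jt in bt.
  - have [ja|ja] := eqVneq j a; first by rewrite -ja jt in at'.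
    have : j \in Z s :\ a by rewrite !inE ja.
    by rewrite sc inE => /eqP jc; rewrite -jc jt in ct.
have cT : (2 < #|~: M|)%N by have := cardsC M; rewrite card_ord; lia.
have /set0Pn[t tT] : ~: M != set0 by rewrite -card_gt0; lia.
have /set0Pn[j jt] : Z t != set0 by rewrite -card_gt0 cardZ.
(* At least three indices avoid [M], but only two of the sets contain [j]. *)
have /subsetPn[u uT ju] : ~~ (~: M \subset col j).
  by apply/negP => /subset_leq_card; rewrite cardZt; lia.
exists r, s, t, u; split; rewrite ?TP //.
by apply: contraNneq ju => tu; rewrite inE -tu.
Qed.

End TwoRegular.

(** * Zeros and cubed row ratios in a general unit weighing matrix *)

Section UnitWeighing.

Context {R : realType} {n p : nat} {W : 'M[R[i]]_n}.
Hypothesis uwW : unit_weighing p W.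

Definition zeros (i : 'I_n) : {set 'I_n} := [set j | W i j == 0].

Lemma norm_off_zeros {i j} : j \notin zeros i -> `|W i j| = 1.
Proof.
by rewrite inE; have [/(_ i j)[/eqP->//|->]] := uwW; rewrite eqxx.
Qed.

Lemma sum_row_conj i j : \sum_k W i k * (W j k)^* = p%:R *+ (i == j).
Proof.
have [_ /matrixP/(_ i j)] := uwW.
rewrite !mxE mulr_natr => <-.
by apply: eq_bigr => k _; rewrite !mxE.
Qed.

Lemma card_zeros i : (#|zeros i| + p)%N = n.
Proof.
suff <- : #|~: zeros i| = p by rewrite cardsC card_ord.
apply/eqP; rewrite -(eqr_nat R[i]); apply/eqP.
have := sum_row_conj i i; rewrite eqxx mulr1n => <-.
rewrite -sumr_const big_mkcond; apply: eq_bigr => k _.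
rewrite inE; case: ifPn => [/norm_off_zeros/norm1_mul_conj->//|].
by rewrite negbK inE => /eqP->; rewrite mul0r.
Qed.

(** A right inverse of a square matrix is also a left inverse. This transfers the count of zeros
    from rows to columns. *)
Lemma unit_weighing_adj : (0 < p)%N -> unit_weighing p (W ^t*)%sesqui.
Proof.
have [_ WW] := uwW; move=> p_gt0; split=> [i j|].
  rewrite !mxE; case: (boolP (i \in zeros j)) => [|/norm_off_zeros Wji].
    by rewrite inE => /eqP->; right; rewrite rmorph0.
  by left; rewrite inE norm_conjC Wji.
have p0 : p%:R != 0 :> R[i] by rewrite pnatr_eq0 -lt0n.
rewrite trmxCK.
have : (p%:R^-1 *: W) *m (W ^t*)%sesqui = 1%:M.
  by rewrite -scalemxAl WW scalerA mulVf // scale1r.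
move/mulmx1C; rewrite -scalemxAr => /(congr1 ( *:%R p%:R)).
by rewrite scalerA mulfV // scale1r.
Qed.

(* On the common support, (W j k)^* is the inverse of W j k. *)
Definition cube_ratio (i j k : 'I_n) : R[i] := (W i k * (W j k)^* ) ^+ 3.

Lemma cube_ratio_trans {i j l k} : k \notin zeros l ->
  cube_ratio i j k = cube_ratio i l k * cube_ratio l j k.
Proof.
move=> /norm_off_zeros/norm1_mul_conj Wlk; rewrite /cube_ratio -exprMn.
by rewrite -[X in X ^+ 3 = _]mulr1 -Wlk; congr (_ ^+ 3); ring.
Qed.

End UnitWeighing.

(** * Order 7 and weight 5 *)

Section UnitWeighing75.

Context {R : realType} {W : 'M[R[i]]_7}.
Hypothesis uwW : unit_weighing 5 W.

Let Z := zeros (W := W).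
Let q := cube_ratio (W := W).

Lemma card_row_zeros i : #|Z i| = 2%N.
Proof. by apply: (@addIn 5); rewrite card_zeros. Qed.

Lemma card_col_zeros j : #|[set i | j \in Z i]| = 2%N.
Proof.
apply: (@addIn 5); rewrite -[RHS](card_zeros (unit_weighing_adj uwW isT) j).
congr (#|pred_of_set _| + _)%N.
by apply/setP => i; rewrite !inE !mxE fmorph_eq0.
Qed.

Lemma sum_off_zeros {i j} : i != j ->
  \sum_(k in ~: (Z i :|: Z j)) W i k * (W j k)^* = 0.
Proof.
move=> ij; have := sum_row_conj uwW i j; rewrite (negPf ij) mulr0n => s0.
rewrite -[RHS]s0 big_mkcond; apply: eq_bigr => k _; rewrite !inE.
case: eqP => [->|_] /=; first by rewrite mul0r.
by case: eqP => [->|_] //=; rewrite rmorph0 mulr0.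
Qed.

Lemma norm_ratio {i j} :
  {in ~: (Z i :|: Z j), forall k, `|W i k * (W j k)^*| = 1}.
Proof.
move=> k; rewrite in_setC in_setU negb_or => /andP[ki kj].
by rewrite normrM norm_conjC !(norm_off_zeros uwW) ?mulr1.
Qed.

(** Orthogonality of the two rows is a vanishing sum over the 7 - 4 = 3 common support columns. *)
Lemma cube_ratio_const_disjoint {i j k l} : [disjoint Z i & Z j] ->
  k \notin Z i -> k \notin Z j -> l \notin Z i -> l \notin Z j ->
  q i j k = q i j l.
Proof.
move=> dij ki kj li lj.
have ij : i != j.
  apply: contraTneq dij => ->; rewrite -setI_eq0 setIid -card_gt0.
  by rewrite card_row_zeros.
have c3 : #|~: (Z i :|: Z j)| = 3%N.
  have := cardsC (Z i :|: Z j); rewrite card_ord cardsU !card_row_zeros.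
  by move: dij; rewrite -setI_eq0 => /eqP->; rewrite cards0; lia.
by apply: (unimodular_sum_card3 c3 norm_ratio (sum_off_zeros ij));
  rewrite in_setC in_setU negb_or ?ki ?kj ?li ?lj.
Qed.

Lemma cube_ratio_const_via {i j t k l} : [disjoint Z t & Z i :|: Z j] ->
  k \notin Z i -> k \notin Z j -> k \notin Z t ->
  l \notin Z i -> l \notin Z j -> l \notin Z t -> q i j k = q i j l.
Proof.
rewrite -setI_eq0 setIUr setU_eq0 !setI_eq0 => /andP[ti tj] ki kj kt li lj lt.
rewrite /q (cube_ratio_trans uwW kt) (cube_ratio_trans uwW lt).
congr (_ * _); last exact: cube_ratio_const_disjoint.
by apply: cube_ratio_const_disjoint; rewrite // disjoint_sym.
Qed.

(** Here the common support has 7 - 3 = 4 columns, so the four-term obstruction applies. *)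
Lemma cube_ratio_const_contra {r s i j k} : #|Z r :&: Z s| = 1%N ->
  i \notin Z r -> i \notin Z s -> j \notin Z r -> j \notin Z s ->
  k \notin Z r -> k \notin Z s -> uniq [:: i; j; k] ->
  q r s i = q r s j -> q r s i = q r s k -> False.
Proof.
move=> rs1 ir is_ jr js kr ks ijk.
have rs : r != s by apply: contra_eq_neq rs1 => ->; rewrite setIid card_row_zeros.
have c4 : #|~: (Z r :|: Z s)| = 4%N.
  have := cardsC (Z r :|: Z s).
  by rewrite card_ord cardsU !card_row_zeros rs1 => -[].
by apply: (unimodular_sum_card4 c4 norm_ratio (sum_off_zeros rs)) ijk;
  rewrite in_setC in_setU negb_or ?ir ?is_ ?jr ?js ?kr ?ks.
Qed.

End UnitWeighing75.

Theorem theorem17 (R : realType) :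
  ~ exists W : 'M[R[i]]_7, unit_weighing 5 W.
Proof.
case=> W uwW; pose Z := zeros (W := W); pose q := cube_ratio (W := W).
have cZ (i : 'I_7) : #|Z i| = 2%N := card_row_zeros uwW i.
have [//|//|r [s [t [u [rs1 dt du tu]]]]] :=
  two_regular_configuration cZ (card_col_zeros uwW).
have out v k : [disjoint Z v & Z r :|: Z s] -> k \in Z v ->
    (k \notin Z r) * (k \notin Z s).
  by move=> dv /(disjointFr dv)/negbT; rewrite in_setU negb_or => /andP[].
have /subsetPn[k kt ku] : ~~ (Z t \subset Z u).
  by apply: contra tu => tu; rewrite eqEcard tu !cZ.
have /subsetPn[l lu lt] : ~~ (Z u \subset Z t).
  by apply: contra tu => ut; rewrite eq_sym eqEcard ut !cZ.
have kl : k != l by apply: contraNneq ku => ->.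
have [kr ks] := out t k dt kt; have [lr ls] := out u l du lu.
(* If [Z t] and [Z u] meet, the four zero sets cover at most 3 + 3 columns, and some [j] supports
   all four rows: going through [u] links [j] to [k], going through [t] links [j] to [l]. *)
have [tu0|tu0] := boolP [disjoint Z t & Z u]; last first.
  have [j] : exists j, j \in ~: (Z r :|: Z s :|: (Z t :|: Z u)).
    apply/set0Pn; rewrite -card_gt0.
    have := cardsC (Z r :|: Z s :|: (Z t :|: Z u)); rewrite card_ord.
    have := (leq_card_setU (Z r :|: Z s) (Z t :|: Z u)).1.
    move: tu0; rewrite -setI_eq0 -card_gt0 !(cardsU (Z _)) !cZ rs1; lia.
  rewrite in_setC !in_setU => /norP[/norP[jr js] /norP[jt ju]].
  apply: (cube_ratio_const_contra uwW rs1 jr js kr ks lr ls).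
  - rewrite /= !inE negb_or kl !andbT; apply/andP; split.
      by apply: contraNneq jt => ->.
    by apply: contraNneq ju => ->.
  - exact: (cube_ratio_const_via uwW du).
  - exact: (cube_ratio_const_via uwW dt).
(* In the disjoint case both elements [k] and [j] of [Z t] avoid [Z u], so [u] links them; linking
   [k] to [l] is the harder part. *)
have [j] : exists j, j \in Z t :\ k.
  apply/set0Pn; rewrite -card_gt0.
  by rewrite -(ltn_add2l (k \in Z t)) -cardsD1 cZ kt.
rewrite in_setD1 => /andP[jk jt].
have [jr js] := out t j dt jt; have ju := negbT (disjointFr tu0 jt).
have kl3 : uniq [:: k; j; l].
  rewrite /= !inE negb_or eq_sym jk kl /= andbT.
  by apply: contraNneq lt => <-.
apply: (cube_ratio_const_contra uwW rs1 kr ks jr js lr ls kl3).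
  exact: (cube_ratio_const_via uwW du).
(* Now Z t and Z u partition the common support of r and s, and going through t
   only or u only never leaves one part; the two values are linked through the
   columns c and b, outside Z r and Z s respectively. *)
have [nrs nsr] : ~~ (Z r \subset Z s) /\ ~~ (Z s \subset Z r).
  by split; apply/negP => /setIidPl rsE; move: rs1; rewrite ?rsE 1?setIC ?rsE cZ.
have /subsetPn[b br bs] := nrs; have /subsetPn[c cs cr] := nsr.
have off v x : [disjoint Z v & Z r :|: Z s] -> x \in Z r :|: Z s -> x \notin Z v.
  by rewrite disjoint_sym => dv /(disjointFr dv)/negbT.
have bU : b \in Z r :|: Z s by rewrite in_setU br.
have cU : c \in Z r :|: Z s by rewrite in_setU cs orbT.
have [bt bu] := (off t b dt bU, off u b du bU).
have [ct cu] := (off t c dt cU, off u c du cU).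
move: dt du; rewrite -!setI_eq0 !setIUr !setU_eq0 !setI_eq0.
move=> /andP[tr ts] /andP[ur us].
have const x y m m' : [disjoint Z x & Z y] -> m \notin Z x -> m \notin Z y ->
  m' \notin Z x -> m' \notin Z y -> q x y m = q x y m'.
  exact: cube_ratio_const_disjoint.
transitivity (q r u c * q u t c * q t s b).
  rewrite /q (cube_ratio_trans uwW ku) -/q -mulrA; congr (_ * _).
    by apply: const; rewrite // disjoint_sym.
  (* The middle factor can move from [c] to [b], as both columns avoid [Z t] and [Z u]. *)
  rewrite (const _ _ c b) //; last by rewrite disjoint_sym.
  by rewrite /q -(cube_ratio_trans uwW bt); exact: const.
rewrite /q -(cube_ratio_trans uwW cu) (cube_ratio_trans uwW lt).
by congr (_ * _); apply: const; rewrite // disjoint_sym.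
Qed.
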